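(* Let $\mathfrak{B}$ be a bornology with a compact base on a Tychonoff space $X$. Then $l(C_{\mathfrak{B}}(X))\ge st(X^n)$ for every integer $n\ge 1$.
   Context: A bornology $\mathfrak{B}$ on $X$ is a family of subsets of $X$ that is closed under taking subsets and finite unions and covers $X$; by standing convention $X\notin\mathfrak{B}$. A base of $\mathfrak{B}$ is a subfamily $\mathfrak{B}_0\subseteq\mathfrak{B}$ such that every $B\in\mathfrak{B}$ is contained in some $B_0\in\mathfrak{B}_0$; it is compact if its members are compact. $C_{\mathfrak{B}}(X)$ is the set $C(X)$ of continuous real-valued functions on $X$ with the topology of uniform convergence on $\mathfrak{B}$, in which the sets $\{g\in C(X):|f(x)-g(x)|<\varepsilon\ \forall x\in B\}$ ($B\in\mathfrak{B}$, $\varepsilon>0$) form a neighbourhood base at $f$. For a space $Y$, the Lindelöf number $l(Y)$ is the smallest infinite cardinal $\mathfrak{m}$ such that each open cover of $Y$ has a subcover of cardinality at most $\mathfrak{m}$. A family $\mathcal{C}$ of nonempty subsets of $Y$ is a $\pi$-network at $y\in Y$ if each neighbourhood of $y$ contains some member of $\mathcal{C}$. The supertightness $st(y,Y)$ of $y$ is the smallest cardinal $\mathfrak{m}$ such that each $\pi$-network $\mathcal{C}$ at $y$ consisting of finite subsets of $Y$ has a subcollection $\mathcal{D}$ with $|\mathcal{D}|\le\mathfrak{m}$ that is a $\pi$-network at $y$; and $st(Y)=\omega\cdot\sup\{st(y,Y):y\in Y\}$. *)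

(* Defs.v *)
From HB Require Import structures.
From mathcomp Require Import all_boot all_order all_algebra.
From mathcomp Require Import all_classical all_reals all_analysis.
Set Implicit Arguments.
Unset Strict Implicit.
Unset Printing Implicit Defensive.
Import Order.TTheory GRing.Theory Num.Theory.
Import numFieldNormedType.Exports.
Local Open Scope classical_set_scope.
Local Open Scope card_scope.
Local Open Scope ring_scope.

(* A cardinal is represented by a type; [m <= k] is
   [[set: m] #<= [set: k]], the existence of an injection. *)

Definition is_least_card (P : Type -> Prop) (m : Type) : Prop :=
  P m /\ forall k : Type, P k -> [set: m] #<= [set: k].

(* [unit] is a junk value, returned only when no type satisfies [P]
   (see [least_cardP]). *)
Definition least_card (P : Type -> Prop) : Type :=
  match pselect (exists m, is_least_card P m) with
  | left h => projT1 (cid h)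
  | right _ => unit
  end.

Definition card_sup (I : Type) (k : I -> Type) : Type :=
  least_card (fun m => forall i, [set: k i] #<= [set: m]).

Lemma set_inj_card_le (T U : Type) (A : set T) (B : set U) (f : T -> U) :
  set_fun A B f -> set_inj A f -> A #<= B.
Proof.
move=> fAB finj; have [g] : $|{injfun A >-> B}| by apply/injfunPex; exists f.
exact: inj_card_le.
Qed.

Lemma ex_least_set (T : Type) (F : set (set T)) : F !=set0 ->
  exists2 A, F A & forall A', F A' -> A #<= A'.
Proof.
move=> [A1 FA1].
pose I := {A | F A}.
pose P (G : set (I -> T)) := (forall g, G g -> forall i, sval i (g i)) /\
  forall g h i, G g -> G h -> g i = h i -> g = h.
have [| G [[Gin Ginj] Gmax]] := @Zorn_bigcup (I -> T) P.
  move=> H HP Htot; split=> [g [G HG Gg] i|g h i [G HG Gg] [G' HG' G'h]].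
    exact: (HP _ HG).1 Gg i.
  have [GG'|G'G] := Htot _ _ HG HG'.
    by apply: (HP _ HG').2 => //; exact: GG'.
  by apply: (HP _ HG).2 => //; exact: G'G.
have [[i Gi]|nsurj] := pselect (exists i : I, sval i `<=` [set g i | g in G]).
  exists (sval i); first exact: (svalP i).
  move=> A' FA'; pose j : I := exist _ A' FA'.
  apply: (@card_le_trans _ _ _ G).
    apply: card_le_trans (subset_card_le Gi) _; exact: card_image_le.
  apply: (@set_inj_card_le _ _ _ _ (fun g => g j)).
    by move=> g Gg; exact: (Gin _ Gg j).
  by move=> g h /set_mem Gg /set_mem Gh; exact: Ginj.
have /choice[g0 g0P] (i : I) :
    exists t, sval i t /\ ~ [set g i | g in G] t.
  apply: contrapT => /forallNP it; apply: nsurj; exists i => t st.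
  by apply: contrapT => nt; apply: (it t).
exfalso; apply: (Gmax (G `|` [set g0])).
  split; first by move=> g; left.
  move=> /(_ g0 (or_intror erefl)) Gg0.
  by apply: (g0P (exist _ A1 FA1)).2; exists g0.
split=> [g [/Gin//|-> i]|g h i]; first by case: (g0P i).
move=> [Gg|->] [Gh|->] //.
- exact: Ginj.
- by move=> e; case: (g0P i) => _ []; exists g.
- by move=> e; case: (g0P i) => _ []; exists h.
Qed.

Lemma card_le_total (T U : Type) (A : set T) (B : set U) :
  A #<= B \/ B #<= A.
Proof.
pose A' : set (T + U) := [set inl x | x in A].
pose B' : set (T + U) := [set inr x | x in B].
have AA' : A #<= A'.
  by apply: (@set_inj_card_le _ _ _ _ inl) => [x Ax|x y _ _ []//]; exists x.
have BB' : B #<= B'.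
  by apply: (@set_inj_card_le _ _ _ _ inr) => [x Ax|x y _ _ []//]; exists x.
have [] := @ex_least_set _ [set A'; B']; first by exists A'; left.
move=> C [->|->] leC; [left|right].
- apply: card_le_trans AA' (card_le_trans (leC _ (or_intror erefl)) _).
  exact: card_image_le.
- apply: card_le_trans BB' (card_le_trans (leC _ (or_introl erefl)) _).
  exact: card_image_le.
Qed.

Lemma least_cardP (P : Type -> Prop) : (exists m, P m) ->
  is_least_card P (least_card P).
Proof.
move=> [m0 Pm0]; rewrite /least_card; case: pselect => [h|[]].
  exact: projT2 (cid h).
pose F : set (set m0) := [set A | exists2 k : Type, P k & [set: k] #= A].
have [|A [k Pk kA] leA] := @ex_least_set m0 F.
  by exists setT, m0 => //; exact: card_eqxx.
have {}kA := (card_eqPle _ _).1 kA.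
exists k; split=> // k' Pk'.
have [k'm|mk'] := card_le_total [set: k'] [set: m0]; last first.
  apply: card_le_trans kA.1 (card_le_trans _ mk').
  exact: subset_card_le.
have [f] := card_leP k'm.
pose g (x : k') : m0 := val (f (SigSub (mem_set (I : [set: k'] x)))).
have ginj : injective g.
  move=> x y /val_inj e.
  by have /(congr1 val) := 'inj_f (mem_set I) (mem_set I) e.
have gk' : [set: k'] #= range g.
  apply/card_eqPle; split; last exact: card_image_le.
  by apply: (@set_inj_card_le _ _ _ _ g) => [x _|x y _ _ /ginj//]; exists x.
apply: card_le_trans kA.1 (card_le_trans (leA (range g) _) _).
  by exists k'.
exact: card_image_le.
Qed.

Lemma card_supP (I : Type) (k : I -> Type) :
  is_least_card (fun m => forall i, [set: k i] #<= [set: m]) (card_sup k).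
Proof.
apply: least_cardP; exists {i : I & k i} => i.
apply: (@set_inj_card_le _ _ _ _ (existT k i)) => // x y _ _.
move=> e; have := projT2_eq e.
by rewrite (Prop_irrelevance (projT1_eq e) erefl).
Qed.


Section invariants.
Variable Y : topologicalType.

Definition open_cover (U : set (set Y)) : Prop :=
  U `<=` open /\ \bigcup_(A in U) A = setT.

Definition lindelof_bound (m : Type) : Prop :=
  forall U : set (set Y), open_cover U ->
    exists V : set (set Y), [/\ V `<=` U, open_cover V & V #<= [set: m]].

Definition lindelof_number : Type :=
  least_card (fun m => infinite_set [set: m] /\ lindelof_bound m).

Definition pi_network (y : Y) (C : set (set Y)) : Prop :=
  (forall A, C A -> A !=set0) /\
  (forall N, nbhs y N -> exists2 A, C A & A `<=` N).

Definition supertight_bound (y : Y) (m : Type) : Prop :=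
  forall C : set (set Y), pi_network y C -> C `<=` finite_set ->
    exists D : set (set Y), [/\ D `<=` C, pi_network y D & D #<= [set: m]].

Definition supertightness_at (y : Y) : Type := least_card (supertight_bound y).

Definition supertightness : Type := (nat * card_sup supertightness_at)%type.

Lemma lindelof_numberP :
  is_least_card (fun m => infinite_set [set: m] /\ lindelof_bound m)
    lindelof_number.
Proof.
apply: least_cardP; exists (nat + set Y)%type; split.
  apply/infiniteP; apply: (@set_inj_card_le _ _ _ _ inl) => //.
  by move=> x y _ _ [].
move=> U Uc; exists U; split=> //.
by apply: (@set_inj_card_le _ _ _ _ inr) => // x y _ _ [].
Qed.

Lemma supertightness_atP (y : Y) :
  is_least_card (supertight_bound y) (supertightness_at y).
Proof.
apply: least_cardP; exists (set Y) => C piC _; exists C; split=> //.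
exact: subset_card_le.
Qed.

End invariants.

(* Finite unions include the empty union, so [set0] belongs to [B]. *)
Record bornology (X : Type) (B : set (set X)) : Prop := Bornology {
  bornology_subset : forall A C, A `<=` C -> B C -> B A ;
  bornology_bigcup : forall F : set (set X),
    finite_set F -> F `<=` B -> B (\bigcup_(A in F) A) ;
  bornology_cover : \bigcup_(A in B) A = setT ;
  bornology_proper : ~ B setT }.

Definition has_compact_base (X : topologicalType) (B : set (set X)) : Prop :=
  exists B0 : set (set X), [/\ B0 `<=` B, B0 `<=` compact &
    forall A, B A -> exists2 A0, B0 A0 & A `<=` A0].

Definition tychonoff_space (X : topologicalType) : Prop :=
  completely_regular_space X /\ hausdorff_space X.

(* C(X) with the topology induced by uniform convergence on the members of
   [B]; [nbhs_CB] below gives the neighbourhood bases. *)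
Definition CB (X : topologicalType) (R : realType) (B : set (set X)) : Type :=
  continuousType X R.

HB.instance Definition _ (X : topologicalType) (R : realType)
  (B : set (set X)) := Choice.on (CB R B).
HB.instance Definition _ (X : topologicalType) (R : realType)
    (B : set (set X)) :=
  Topological.copy (CB R B)
    (@initial_topology (CB R B) {family B, X -> R} (fun f => f : X -> R)).

Lemma nbhs_CB (X : topologicalType) (R : realType) (B : set (set X))
    (f : CB R B) (N : set (CB R B)) : bornology B ->
  nbhs f N <-> exists A (e : R), [/\ B A, 0 < e &
    [set g : CB R B | forall x, A x -> `|f x - g x| < e] `<=` N].
Proof.
move=> bB; split; last first.
  move=> [A [e [BA e0 sN]]].
  apply: filterS sN _.
  have : nbhs (f : {family B, X -> R})
      [set g | forall x, A x -> ball (f x) e (g x)].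
    apply: (@fam_nbhs X R B A [set p | ball p.1 e p.2]) => //.
    exact: entourage_ball (PosNum e0).
  exact: (@initial_continuous (CB R B) {family B, X -> R}
    (fun f => f : X -> R) f).
rewrite nbhsE => -[_ [[W oW <-] Wf] sN].
have B0 : B set0.
  have := @bornology_bigcup _ _ bB set0 (@finite_set0 _) (@sub0set _ _).
  by rewrite bigcup_set0.
pose b (p : set X * R) := [set g : X -> R | forall x, p.1 x -> `|f x - g x| < p.2].
pose F := filter_from [set p : set X * R | B p.1 /\ 0 < p.2] b.
have FF : Filter F.
  apply: filter_from_filter; first by exists (set0, 1); split; [exact: B0|exact: ltr01].
  move=> [A a] [C c] [BA a0] [BC c0].
  exists (A `|` C, Order.min a c); rewrite /b /=.
    split; last by rewrite lt_min a0.
    have -> : A `|` C = \bigcup_(D in [set A; C]) D.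
      by rewrite bigcup_setU !bigcup_set1.
    apply: (bornology_bigcup bB) => [|D [->|->]//].
    by rewrite finite_setU; split; exact: finite_set1.
  move=> g Hg; split=> x Dx; have := Hg x.
    by move=> /(_ (or_introl Dx)); rewrite lt_min => /andP[].
  by move=> /(_ (or_intror Dx)); rewrite lt_min => /andP[].
have cF : {family B, F --> (f : X -> R)}.
  apply/fam_cvgP => A BA P /uniform_nbhs [E [entE sP]].
  move: entE; rewrite -(@entourage_ballE R) => -[e e0 eE].
  exists (A, e) => // g Hg; apply: sP => x Ax /=.
  by apply: eE => /=; exact: Hg.
have [ [A e] [BA e0] sO] : F W.
  by apply: cF; apply: open_nbhs_nbhs.
by exists A, e; split=> // g Hg; apply: sN; exact: sO.
Qed.

(* X^n with the product topology. *)
Definition power_space (X : topologicalType) (n : nat) : topologicalType :=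
  prod_topology (fun _ : 'I_n => X).

(* Main.v *)
Require Import Defs.
From mathcomp Require Import all_boot all_order all_algebra.
From mathcomp Require Import all_classical all_reals all_analysis.
Local Open Scope classical_set_scope.
Local Open Scope card_scope.

Import Order.TTheory GRing.Theory Num.Theory.
Import numFieldNormedType.Exports.
Set Implicit Arguments.
Unset Strict Implicit.

(** The argument is the one behind Asanov's theorem on the tightness of the
  powers of [X].  Let [m] be the Lindelof number of C_B(X), let [y] be a point
  of X^n and let [C] be a pi-network at [y] made of finite sets.  Around the
  coordinates of [y] choose neighbourhoods [W i] that can meet only when the
  coordinates coincide, and keep only the members of [C] that lie in the box
  of the [W i].

  The functions that vanish at all the coordinates of [y] form a closed subset
  of C_B(X).  It is covered by the sets [V A], for [A] a remaining member of
  [C], of the functions that take the value 1 at no coordinate of a point of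
  [A]: if [f] vanishes at the coordinates of [y], the points at whose
  coordinates [f] is not 1 form a neighbourhood of [y], and this neighbourhood
  contains some [A].  Each [V A] is open because [A] is finite and evaluation
  at a point is continuous.  So at most [m] of the sets [A] give a subcover.

  These [A] already form a pi-network at [y].  Given a box around [y], complete
  regularity gives an [f] that vanishes at the coordinates of [y] and is 1
  outside a union of smaller neighbourhoods of them
  ([completely_regular_fin_separation]); some chosen [V A] contains [f], which
  puts the coordinates of the points of [A] in that union.  As [A] lies in the
  box of the [W i], each of these coordinates is near the right coordinate of
  [y], hence [A] is contained in the given box ([supertight_bound_CB]).

  Thus [m] bounds the supertightness at every point, hence the supremum of the
  local supertightnesses; the factor omega in the supertightness is absorbed
  since [m] is infinite ([infinite_nat_prod_card_le]). *)

(** * Countable multiples of an infinite cardinal *)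

Lemma card_leT_injection (T U : Type) (A : set U) : [set: T] #<= A ->
  exists2 h : T -> U, forall x, A (h x) & injective h.
Proof.
move=> /card_leP[f].
pose s x : {x : T | x \in [set: T]} := SigSub (mem_set (I : [set: T] x)).
exists (fun x => val (f (s x))) => [x|x y /val_inj e].
  exact: set_mem (valP (f (s x))).
by have /(congr1 val) := 'inj_f (mem_set I) (mem_set I) e.
Qed.

(** By Zorn's lemma an infinite type is, up to a finite set, a disjoint union of
  countable sequences, and countably many copies of a sequence can be packed
  into that same sequence. *)
Lemma infinite_nat_prod_card_le (m : Type) : infinite_set [set: m] ->
  [set: nat * m] #<= [set: m].
Proof.
move=> minf.
pose P (G : set (nat -> m)) := (forall g, G g -> injective g) /\
  forall g h k l, G g -> G h -> g k = h l -> g = h.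
have [|G [[Ginj Gdisj] Gmax]] := @Zorn_bigcup (nat -> m) P.
  move=> H HP Htot; split=> [g [G HG Gg]|g h k l [G HG Gg] [G' HG' G'h]].
    exact: (HP _ HG).1 Gg.
  have [GG'|G'G] := Htot _ _ HG HG'.
    by apply: (HP _ HG').2 => //; exact: GG'.
  by apply: (HP _ HG).2 => //; exact: G'G.
(* By maximality of [G] the points missed by all its sequences are finitely
   many. *)
pose L := ~` \bigcup_(g in G) range g.
have Lfin : finite_set L.
  apply: contrapT => /infiniteP/card_leT_injection[h Lh hinj].
  apply: (Gmax (G `|` [set h])).
    split; first by move=> g; left.
    by move=> /(_ h (or_intror erefl)) Gh; apply: (Lh 0%N); exists h => //; exists 0%N.
  split=> [g [/Ginj//|->//]|f g k l [Gf|->] [Gg|->] // e].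
  - exact: Gdisj e.
  - by exfalso; apply: (Lh l); exists f => //; exists k.
  - by exfalso; apply: (Lh k); exists g => //; exists l.
have [g0 Gg0] : exists g, G g.
  apply: contrapT => /forallNP G0; apply: minf; apply: sub_finite_set Lfin.
  by move=> x _ [g /G0].
have /pcard_injP[r rinj] := finite_set_countable Lfin.
(* [c x] codes [x] by a sequence of [G] and a position in it; a missed point
   is given to the arbitrary sequence [g0], on a second copy of [nat]. *)
have /choice[c cP] (x : m) : exists c : (nat -> m) * (nat + nat), G c.1 /\
    match c.2 with inl k => c.1 k = x | inr k => L x /\ k = r x end.
  have [[g Gg [k _ gk]]|Lx] := pselect ((\bigcup_(g in G) range g) x).
    by exists (g, inl k).
  by exists (g0, inr (r x)).
pose f (p : nat * m) : m := (c p.2).1 (pickle (p.1, (c p.2).2)).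
apply: (@set_inj_card_le _ _ _ _ f) => // -[i x] [j y] _ _ e.
have [Gx cx] := cP x; have [Gy cy] := cP y.
have gE := Gdisj _ _ _ _ Gx Gy e.
move: e; rewrite /f /= gE => /(Ginj _ Gy)/(pcan_inj pickleK)[-> cE].
congr (_, _); rewrite gE cE in cx.
move: cx cy; case: (c y).2 => k; first by move=> -> ->.
by move=> [Lx ->] [Ly /rinj]; apply; exact/mem_set.
Qed.

(** * Neighbourhoods in powers of a space *)

(** The boxes with sides in the [nbhs (y i)] generate a filter, and this filter
  converges to [y] since all its projections converge. *)
Lemma nbhs_prod_box (I : Type) (T : I -> topologicalType)
    (y : prod_topology T) (N : set (prod_topology T)) : nbhs y N ->
  exists2 U : forall i, set (T i), forall i, nbhs (y i) (U i) &
    [set z : prod_topology T | forall i, U i (z i)] `<=` N.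
Proof.
move=> yN.
pose F := filter_from [set U : forall i, set (T i) | forall i, nbhs (y i) (U i)]
  (fun U => [set z : prod_topology T | forall i, U i (z i)]).
have FF : Filter F.
  apply: filter_from_filter; first by exists (fun=> setT) => i; exact: filterT.
  move=> U V yU yV; exists (fun i => U i `&` V i).
    by move=> i; exact: filterI (yU i) (yV i).
  by move=> z UV; split=> i; case: (UV i).
suff /(_ _ yN)[U yU UN] : F --> y by exists U.
apply/cvg_sup => i Q [V [[W oW <-] Wy] /= WQ]; apply: filterS WQ _.
(* The preimage of [W] under the [i]-th projection, as a box. *)
exists (fun j => [set a | forall e : j = i, W (ecast k (T k) e a)]).
  move=> j; have [e|ne] := pselect (j = i); last first.
    by apply: filterE => a e; case: (ne e).
  subst i; apply: filterS (open_nbhs_nbhs (conj oW Wy)) => a Wa e.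
  by rewrite (Prop_irrelevance e erefl).
by move=> z /(_ i erefl).
Qed.

Lemma nbhs_box (X : topologicalType) (n : nat) (y : power_space X n)
    (U : 'I_n -> set X) : (forall i, nbhs (y i) (U i)) ->
  nbhs y [set z : power_space X n | forall i, U i (z i)].
Proof.
move=> yU; apply: (@filter_forall _ _ (fun i => [set z : power_space X n | U i (z i)])
  (nbhs y) (nbhs_filter y)) => i.
exact: (@proj_continuous _ (fun _ : 'I_n => X) i y _ (yU i)).
Qed.

(** The coordinates of [y] may repeat, so the neighbourhoods cannot be made
  pairwise disjoint; they meet only over equal coordinates. *)
Lemma hausdorff_separating_nbhs (X : topologicalType) (n : nat)
    (y : 'I_n -> X) : hausdorff_space X ->
  exists2 W : 'I_n -> set X, forall i, nbhs (y i) (W i) &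
    forall i j a, W i a -> W j a -> y i = y j.
Proof.
rewrite open_hausdorff => hX.
have /choice[S SP] (p : X * X) : exists S : set X * set X,
    [/\ nbhs p.1 S.1, nbhs p.2 S.2 & p.1 <> p.2 -> S.1 `&` S.2 = set0].
  have [e|/eqP ne] := pselect (p.1 = p.2).
    by exists (setT, setT); split=> //; exact: filterT.
  have [[/= U V] [/set_mem Up /set_mem Vp] [oU oV UV]] := hX _ _ ne.
  exists (U, V); split=> [||_] /=; last exact/eqP.
  - exact: open_nbhs_nbhs.
  - exact: open_nbhs_nbhs.
exists (fun i => [set a | forall j, (S (y i, y j)).1 a /\ (S (y j, y i)).2 a]).
  move=> i; apply: filter_forall => j; apply: filterI.
    by case: (SP (y i, y j)).
  by case: (SP (y j, y i)).
move=> i j a /(_ j)[ai _] /(_ i)[_ aj]; apply: contrapT => ne.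
have [_ _ /(_ ne) S0] := SP (y i, y j).
by have : set0 a by rewrite -S0.
Qed.

(** * Lindelof bounds on the function space *)

(** The product of functions separating the single points from [C]. *)
Lemma completely_regular_fin_separation (R : realType) (X : topologicalType)
    (I : finType) (y : I -> X) (C : set X) :
    completely_regular_space X -> closed C -> (forall i, ~ C (y i)) ->
  exists f : X -> R, [/\ continuous f, forall i, f (y i) = 0%R &
    forall x, C x -> f x = 1%R].
Proof.
move=> crX clC Cy.
have /choice[f fP] (i : I) : exists f : X -> R,
    [/\ continuous f, f (y i) = 0%R & forall x, C x -> f x = 1%R].
  have /(@uniform_separatorP _ R)[f [cf _ f0 f1]] := crX _ _ clC (Cy i).
  exists f; split=> //; first by apply: f0; exists (y i).
  by move=> x Cx; apply: f1; exists x.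
exists (fun x => \prod_i f i x)%R; split.
- apply: (@continuous_big R I *%R 1%R).
    by move=> /= p; exact: mul_continuous.
  by move=> i _; case: (fP i).
- by move=> i; rewrite (bigD1 i)//=; case: (fP i) => _ -> _; rewrite mul0r.
- by move=> x Cx; rewrite big1// => i _; case: (fP i) => _ _; exact.
Qed.

Section function_space.
Variables (R : realType) (X : topologicalType) (B : set (set X)).
Hypothesis bB : bornology B.

(** A point belongs to some member of the bornology, so uniform convergence on
  the bornology implies pointwise convergence. *)
Lemma open_CB_neq (x : X) (c : R) : open [set f : CB R B | f x <> c].
Proof.
rewrite openE => f /= fx; apply/(nbhs_CB _ _ bB).
exists [set x], `|f x - c|%R; split.
- have [A BA Ax] : (\bigcup_(A in B) A) x by rewrite (bornology_cover bB).
  by apply: (bornology_subset bB) BA => _ ->.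
- by rewrite normr_gt0 subr_eq0; exact/eqP.
- by move=> g /(_ x erefl) + gx; rewrite gx ltxx.
Qed.

(** The Lindelof property is applied to the sets [V A] together with [O], the
  complement of the closed set of functions vanishing at the coordinates
  of [y]. *)
Lemma supertight_bound_CB (n : nat) (y : power_space X n) (m : Type) :
  tychonoff_space X -> lindelof_bound (CB R B) m -> supertight_bound y m.
Proof.
move=> [crX hX] lm C [C0 Cy] Cfin.
have [W yW Wdisj] := @hausdorff_separating_nbhs X n y hX.
pose W' : set (power_space X n) := [set z | forall i, W i (z i)].
pose V A := [set f : CB R B | forall z, A z -> forall i : 'I_n, f (z i) <> 1%R].
pose C' := [set A | C A /\ A `<=` W'].
pose O := [set f : CB R B | exists i, f (y i) <> 0%R].
have oV A : C' A -> open (V A).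
  move=> [CA _]; rewrite openE => f Vf.
  have -> : V A = \bigcap_(z in A) [set g : CB R B | forall i, g (z i) <> 1%R].
    by [].
  have /finite_fsetP[E EA] := Cfin _ CA.
  rewrite EA; apply: filter_bigI => z zE.
  apply: (@filter_forall _ _ (fun i => [set g : CB R B | g (z i) <> 1%R])
    (nbhs f) (nbhs_filter f)) => i.
  apply: open_nbhs_nbhs; split; first exact: open_CB_neq.
  by apply: Vf; rewrite EA.
have oO : open O.
  rewrite (_ : O = \bigcup_(i in setT) [set f : CB R B | f (y i) <> 0%R]).
    by apply: bigcup_open => i _; exact: open_CB_neq.
  by apply/seteqP; split=> [f [i fi]|f [i _ fi]]; exists i.
have [|U [UVO [oU UT] Um]] := lm ((V @` C') `|` [set O]).
  split; first by move=> _ [[A C'A <-]|->//]; exact: oV.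
  apply/seteqP; split=> // f _.
  have [Of|nOf] := pselect (O f); first by exists O => //; right.
  pose G i := W i `&` [set x | f x <> 1%R].
  pose N : set (power_space X n) := [set z | forall i, G i (z i)].
  have yN : nbhs y N.
    apply: (@nbhs_box _ _ _ G) => i; apply: filterI (yW i) _.
    apply: open_nbhs_nbhs; split.
      rewrite (_ : mkset _ = f @^-1` (~` [set 1%R])) //.
      apply: open_comp; first by move=> x _; exact: (@cts_fun _ _ f).
      apply: closed_openC.
      exact: accessible_closed_set1 (hausdorff_accessible (@Rhausdorff R)) _.
    rewrite /=; have -> : f (y i) = 0%R by apply: contrapT => fi; apply: nOf; exists i.
    by apply/eqP; rewrite eq_sym oner_eq0.
  have [A CA AN] := Cy _ yN.
  exists (V A); first by left; exists A => //; split=> // z /AN Nz i; case: (Nz i).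
  by move=> z /AN Nz i; case: (Nz i).
(* Distinct [A] may have the same [V A]; [rep] picks one for each set of the
   subcover. *)
have /choice[rep repP] (v : set (CB R B)) :
    exists A, (V @` C') v -> C' A /\ V A = v.
  have [[A C'A VA]|nv] := pselect ((V @` C') v); first by exists A.
  by exists set0.
exists (rep @` (U `&` (V @` C'))); split.
- by move=> _ [v [_ /repP[[CA _] _]] <-].
- split; first by move=> _ [v [_ /repP[[CA _] _]] <-]; exact: C0.
  move=> N /nbhs_prod_box[Q yQ QN].
  (* [G i] is inside [Q k] for every [k] with the same coordinate as [i]: a
     coordinate in [W k] found in [G i] is then already in [Q k]. *)
  pose G i := (W i `&` [set a | forall k, y i = y k -> Q k a])°.
  have Gy i : G i (y i).
    apply: filterI => //; apply: filter_forall => k.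
    by have [->|ne] := pselect (y i = y k);
      [apply: filterS (yQ k) => a Qa _|apply: filterE => a /ne].
  have [|i|f [cf f0 f1]] := @completely_regular_fin_separation R X _ y
      (~` \bigcup_i G i) crX.
  + by apply: open_closedC; apply: bigcup_open => i _; exact: open_interior.
  + by apply; exists i.
  have [v Uv vf] : (\bigcup_(A in U) A) (mkcts cf : CB R B) by rewrite UT.
  have Vv : (V @` C') v.
    by case: (UVO _ Uv) => // vO; move: vf; rewrite vO => -[i]; rewrite /= /mkcts f0.
  exists (rep v); first by exists v.
  have [[_ AW] VA] := repP _ Vv.
  apply: subset_trans QN => z Az i; move: vf; rewrite -VA => /(_ z Az i) fz.
  have : (\bigcup_i G i) (z i) by apply: contrapT => /f1.
  move=> [j _ /interior_subset[Wj Qj]].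
  by apply: Qj; apply: Wdisj Wj (AW _ Az i).
- apply: card_le_trans (card_image_le _ _) (card_le_trans _ Um).
  by apply: subset_card_le => v [].
Qed.

End function_space.

Theorem theorem5p17 (R : realType) (X : topologicalType) (B : set (set X))
    (tX : tychonoff_space X) (bB : bornology B) (cB : has_compact_base B)
    (n : nat) (n_ge1 : (1 <= n)%N) :
  [set: supertightness (power_space X n)] #<= [set: lindelof_number (CB R B)].
Proof.
have [[minf lm] _] := lindelof_numberP (CB R B).
have supm : [set: card_sup (@supertightness_at (power_space X n))] #<=
    [set: lindelof_number (CB R B)].
  apply: (card_supP (@supertightness_at (power_space X n))).2 => y.
  apply: (supertightness_atP y).2; exact: supertight_bound_CB tX lm.
apply: card_le_trans (infinite_nat_prod_card_le minf).
have [h _ hinj] := card_leT_injection supm.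
apply: (@set_inj_card_le _ _ _ _ (fun p : nat * _ => (p.1, h p.2))) => //.
by move=> [i x] [j z] _ _ [-> /hinj ->].
Qed.
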